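(* Let $u^\pm=(u_1^\pm,u_2^\pm)\in\mathbb R^2$ with $u_2^+>0>u_2^-$, let $\Sigma=\{u\in\mathbb R^2:u_2=0\}$, and let $Q^\pm=\operatorname{diag}(h_1^\pm,h_2^\pm)$ be real diagonal matrices such that at least one of $h_1^-,h_2^-$ is positive and at least one of $h_1^+,h_2^+$ is negative. Let $f(u)=Q^-(u-u^-)$ for $u_2<0$ and $f(u)=Q^+(u-u^+)$ for $u_2>0$. Assume that $u'=f(u)$ has a heteroclinic trajectory $\gamma$ from $u^-$ to $u^+$ crossing $\Sigma$ at $w=\gamma(0)\in\Sigma$, that is, $$\gamma(\xi)=u^-+e^{\xi Q^-}(w-u^-)\ (\xi\le 0),\qquad \gamma(\xi)=u^++e^{\xi Q^+}(w-u^+)\ (\xi\ge 0),$$ with $\gamma(\xi)\to u^\pm$ as $\xi\to\pm\infty$. Then the traveling wave corresponding to $\gamma$ is spectrally stable: every eigenvalue $\lambda\in\mathbb C$ of the spectral problem associated with $\gamma$ satisfies $\operatorname{Re}\lambda<0$ or $\lambda=0$.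
   Context: Spectral problem associated with $\gamma$. Put $\mathbf n=(0,1)$, $\hat f^\pm=Q^\pm(w-u^\pm)$, $\Delta f=\hat f^+-\hat f^-$, and $Sv=v+\Delta f\,\dfrac{\langle v,\mathbf n\rangle}{\langle\hat f^-,\mathbf n\rangle}$. (The crossing is transversal: $\langle\hat f^\pm,\mathbf n\rangle>0$.) A number $\lambda\in\mathbb C$ is an eigenvalue if there is a not identically zero pair of functions $(v,z)$ with values in $\mathbb C^2\times\mathbb C^2$, smooth on $(-\infty,0]$ and on $[0,\infty)$ (with one-sided limits at $0$), such that $$v'=Q^-v+z,\ z'=\lambda v\quad(\xi<0),\qquad v'=Q^+v+z,\ z'=\lambda v\quad(\xi>0),$$ $$v(+0)=Sv(-0),\qquad z(+0)=z(-0),\qquad v(\xi),z(\xi)\to0\ \text{ as }\xi\to\pm\infty.$$ This is the limit, under smoothing of $f$, of the eigenvalue problem $\mathcal Lv=(v'-\partial f(\gamma)v)'=\lambda v$ obtained by linearizing $\partial_t u=-\partial_\xi f(u)+\partial_\xi^2u$ at the stationary solution $\gamma$. *)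

(* Defs.v *)
From HB Require Import structures.
From mathcomp Require Import all_boot all_order all_algebra.
From mathcomp Require Import all_classical all_reals all_analysis.
From mathcomp Require Import complex.

Set Implicit Arguments.
Unset Strict Implicit.
Unset Printing Implicit Defensive.

Import Order.TTheory GRing.Theory Num.Theory.
Import numFieldNormedType.Exports.

Local Open Scope classical_set_scope.
Local Open Scope ring_scope.

(* Vectors of the plane are columns: the coordinates u_1 and u_2 of u are
   u 0 0 and u 1 0. *)

Section PlaneField.
Variable R : realType.
Implicit Types (u um up w : 'cV[R]_2) (Qm Qp A : 'M[R]_2).

Definition Sigma : set 'cV[R]_2 := [set u | u 1 0 = 0].

(* The value of f on Sigma is left unspecified. *)
Definition piecewise_affine Qm Qp um up (f : 'cV[R]_2 -> 'cV[R]_2) : Prop :=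
  (forall u, u 1 0 < 0 -> f u = Qm *m (u - um)) /\
  (forall u, 0 < u 1 0 -> f u = Qp *m (u - up)).

Definition expmx A : 'M[R]_2 :=
  limn (series (fun k : nat => (k`!%:R)^-1 *: A ^+ k)).

(* The trajectory meets Sigma only at xi = 0, where f is unspecified, so
   u' = f(u) is required at all other times; there it already follows from
   the explicit formulas and the limits when um 1 0 < 0 < up 1 0. *)
Record heteroclinic Qm Qp um up w (f : 'cV[R]_2 -> 'cV[R]_2)
    (gamma : R -> 'cV[R]_2) : Prop := Heteroclinic {
  het_cross : Sigma w;
  het_at0 : gamma 0 = w;
  het_ode : forall xi : R, xi != 0 -> is_derive xi 1 gamma (f (gamma xi));
  het_left : forall xi : R, xi <= 0 ->
    gamma xi = um + expmx (xi *: Qm) *m (w - um);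
  het_right : forall xi : R, 0 <= xi ->
    gamma xi = up + expmx (xi *: Qp) *m (w - up);
  het_ninfty : gamma xi @[xi --> -oo] --> um;
  het_pinfty : gamma xi @[xi --> +oo] --> up }.

End PlaneField.

Section ComplexValued.
Variable R : realType.
Implicit Types (g v : R -> 'cV[R[i]]_2) (a b d l : 'cV[R[i]]_2).

Definition cRe a : 'cV[R]_2 := map_mx (@complex.Re R) a.
Definition cIm a : 'cV[R]_2 := map_mx (@complex.Im R) a.
Definition toC m n (A : 'M[R]_(m, n)) : 'M[R[i]]_(m, n) :=
  map_mx (real_complex R) A.

(* R[i] carries no normed R-module structure in the library; limits and
   derivatives of C^2-valued functions of a real variable are those of the
   real and imaginary parts, taken in R^2. *)
Definition ccvg g (F : set_system R) l : Prop :=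
  (cRe (g xi) @[xi --> F] --> cRe l) /\ (cIm (g xi) @[xi --> F] --> cIm l).

Definition is_cderive (xi : R) g d : Prop :=
  is_derive xi 1 (cRe \o g) (cRe d) /\ is_derive xi 1 (cIm \o g) (cIm d).

(* Smoothness on (-oo, 0] and on [0, +oo): derivatives of all orders exist
   off 0 and have one-sided limits at 0.  The value of the function at 0
   plays no role. *)
Definition piecewise_smooth (h : R -> 'cV[R]_2) : Prop :=
  forall n : nat,
    [/\ forall xi : R, xi != 0 -> derivable (derive1n n h) xi 1,
        cvg (derive1n n h xi @[xi --> 0^'-]) &
        cvg (derive1n n h xi @[xi --> 0^'+])].

Definition cpiecewise_smooth g : Prop :=
  piecewise_smooth (cRe \o g) /\ piecewise_smooth (cIm \o g).

(* Bilinear even over the complex numbers: dot is only ever taken against the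
   real vector normal. *)
Definition dot (K : pzRingType) (a b : 'cV[K]_2) : K :=
  \sum_(i < 2) a i 0 * b i 0.

Definition normal : 'cV[R]_2 := delta_mx 1 0.

Section Spectrum.
Variables (Qm Qp : 'M[R]_2) (um up w : 'cV[R]_2).

Definition fhat_m : 'cV[R]_2 := Qm *m (w - um).
Definition fhat_p : 'cV[R]_2 := Qp *m (w - up).

Definition jump a : 'cV[R[i]]_2 :=
  a + (dot a (toC normal) / (real_complex R (dot fhat_m normal)))
        *: toC (fhat_p - fhat_m).

Record eigenpair (lambda : R[i]) (v z : R -> 'cV[R[i]]_2) : Prop := Eigenpair {
  eig_nontrivial : exists xi : R, xi != 0 /\ (v xi != 0 \/ z xi != 0);
  eig_v_smooth : cpiecewise_smooth v;
  eig_z_smooth : cpiecewise_smooth z;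
  eig_left : forall xi : R, xi < 0 ->
    is_cderive xi v (toC Qm *m v xi + z xi) /\ is_cderive xi z (lambda *: v xi);
  eig_right : forall xi : R, 0 < xi ->
    is_cderive xi v (toC Qp *m v xi + z xi) /\ is_cderive xi z (lambda *: v xi);
  eig_v_jump : exists vm vp,
    [/\ ccvg v 0^'- vm, ccvg v 0^'+ vp & vp = jump vm];
  eig_z_cont : exists z0, ccvg z 0^'- z0 /\ ccvg z 0^'+ z0;
  eig_v_ninfty : ccvg v -oo 0;
  eig_v_pinfty : ccvg v +oo 0;
  eig_z_ninfty : ccvg z -oo 0;
  eig_z_pinfty : ccvg z +oo 0 }.

Definition is_eigenvalue (lambda : R[i]) : Prop :=
  exists v z : R -> 'cV[R[i]]_2, eigenpair lambda v z.

End Spectrum.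
End ComplexValued.

(* Main.v *)
Require Import Defs.
From mathcomp Require Import all_boot all_order all_algebra.
From mathcomp Require Import all_classical all_reals all_analysis.
From mathcomp Require Import complex.
From mathcomp Require Import ring lra.

Set Implicit Arguments.
Unset Strict Implicit.
Unset Printing Implicit Defensive.

Import Order.TTheory GRing.Theory Num.Theory.
Import numFieldNormedType.Exports.
Local Open Scope ring_scope.

(* The matrices being diagonal, the spectral problem splits into two scalar
   systems v' = h v + z, z' = lam v on each half line.  If Re lam >= 0 and
   lam <> 0, the characteristic roots of such a system have real parts of
   opposite strict signs, and rho v + z solves y' = rho y for each root rho.
   As |y|^2 is then monotone, decay at infinity forces rho v + z = 0 with
   Re rho < 0 on the left and Re rho > 0 on the right.  Existence of the
   heteroclinic forces h_2^- > 0 > h_2^+, so v_2 jumps by a positive factor k;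
   matching at 0 gives (rho^- - k rho^+) v_2(-0) = 0, hence v_2(-0) = 0 and the
   second component vanishes.  Then v_1 does not jump and the same argument
   applies with k = 1. *)

(** * Exponential of a diagonal matrix *)

Section Exponential.
Local Open Scope classical_set_scope.
Variable R : realType.

Lemma expr_diag_mx (d : 'rV[R]_2) (k : nat) :
  diag_mx d ^+ k = diag_mx (\row_i d 0 i ^+ k).
Proof.
elim: k => [|k IH].
  by apply/matrixP => i j; rewrite expr0 !mxE expr0.
rewrite exprS IH -mulmxE mulmx_diag; congr diag_mx.
by apply/rowP => i; rewrite !mxE exprS.
Qed.

(** The partial sums are diagonal; expanding them over the matrices [delta_mx i i] reduces
    convergence to that of the scalar exponential series. *)
Lemma expmx_diag (d : 'rV[R]_2) : expmx (diag_mx d) = diag_mx (\row_i expR (d 0 i)).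
Proof.
rewrite /expmx [RHS]diag_mx_sum_delta; apply/cvg_lim => //.
rewrite (_ : series _ =
    fun n => \sum_(i < 2) series (exp_coeff (d 0 i)) n *: delta_mx i i); last first.
  apply/funext => n; pose r : 'rV_2 := \row_i series (exp_coeff (d 0 i)) n.
  transitivity (diag_mx r); last first.
    by rewrite diag_mx_sum_delta; under eq_bigr do rewrite mxE.
  apply/matrixP => i j; rewrite /series /= summxE !mxE -sumrMnl.
  by apply: eq_bigr => k _; rewrite expr_diag_mx !mxE mulrnAr mulrC.
apply: cvg_big => [|i _]; first exact: add_continuous.
by rewrite mxE; apply: cvgZr_tmp; exact: is_cvg_series_exp_coeff.
Qed.

End Exponential.

(** * Scalar complex linear equations and the jump problem at 0 *)

Section ScalarEquations.
Local Open Scope classical_set_scope.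
Variable R : realType.
Implicit Types (a b c d l lam mu rho : R[i]) (y v z : R -> R[i]) (F : set_system R) (D : set R).

Lemma ReD_mul c a b :
  complex.Re (c * a + b) =
  complex.Re c * complex.Re a - complex.Im c * complex.Im a + complex.Re b.
Proof. by case: c a b => [? ?] [? ?] [? ?]. Qed.

Lemma ImD_mul c a b :
  complex.Im (c * a + b) =
  complex.Re c * complex.Im a + complex.Im c * complex.Re a + complex.Im b.
Proof. by case: c a b => [? ?] [? ?] [? ?]. Qed.

Definition is_scderive (x : R) y d : Prop :=
  is_derive x 1 (@complex.Re R \o y) (complex.Re d) /\
  is_derive x 1 (@complex.Im R \o y) (complex.Im d).

Definition sccvg y F l : Prop :=
  (complex.Re (y x) @[x --> F] --> complex.Re l) /\
  (complex.Im (y x) @[x --> F] --> complex.Im l).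

Lemma is_scderive_lin (x : R) c y z dy dz :
  is_scderive x y dy -> is_scderive x z dz ->
  is_scderive x (fun t => c * y t + z t) (c * dy + dz).
Proof.
move=> [y1 y2] [z1 z2]; split.
- rewrite (_ : _ \o _ = complex.Re c *: (@complex.Re R \o y)
      - complex.Im c *: (@complex.Im R \o y) + (@complex.Re R \o z)); last first.
    by apply/funext => t; rewrite /= ReD_mul.
  by rewrite (ReD_mul c dy dz);
    exact: (is_deriveD (is_deriveB (is_deriveZ _ y1) (is_deriveZ _ y2)) z1).
- rewrite (_ : _ \o _ = complex.Re c *: (@complex.Im R \o y)
      + complex.Im c *: (@complex.Re R \o y) + (@complex.Im R \o z)); last first.
    by apply/funext => t; rewrite /= ImD_mul.
  by rewrite (ImD_mul c dy dz);
    exact: (is_deriveD (is_deriveD (is_deriveZ _ y2) (is_deriveZ _ y1)) z2).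
Qed.

Lemma sccvg_lin F c y z ly lz : Filter F ->
  sccvg y F ly -> sccvg z F lz ->
  sccvg (fun t => c * y t + z t) F (c * ly + lz).
Proof.
move=> FF [y1 y2] [z1 z2]; split.
- under eq_fun do rewrite ReD_mul.
  by rewrite ReD_mul; apply: cvgD => //; apply: cvgB; apply: cvgMr.
- under eq_fun do rewrite ImD_mul.
  by rewrite ImD_mul; apply: cvgD => //; apply: cvgD; apply: cvgMr.
Qed.

Lemma sccvg_cst F l : Filter F -> sccvg (fun=> l) F l.
Proof. by move=> FF; split; exact: cvg_cst. Qed.

Lemma sccvg_unique F y l l' : ProperFilter F ->
  sccvg y F l -> sccvg y F l' -> l = l'.
Proof.
move=> FF [y1 y2] [y1' y2']; apply/eqP; rewrite eq_complex.
by rewrite (cvg_unique _ y1 y1') ?(cvg_unique _ y2 y2') ?eqxx.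
Qed.

Lemma eq_sccvg F y y' l : Filter F ->
  (\forall t \near F, y t = y' t) -> sccvg y F l -> sccvg y' F l.
Proof.
move=> FF yy' [y1 y2]; split;
  [apply: cvg_trans y1 | apply: cvg_trans y2]; apply: near_eq_cvg;
  by apply: filterS yy' => t ->.
Qed.

(** By the mean value theorem [E t - E x] equals [c * E s * (t - x)], a product of nonnegative
    quantities. The sign condition on [c * (t - x)] covers both directions of time. *)
Lemma growth_le (E : R -> R) (c : R) (D : set R) (x t : R) :
  is_interval D -> D x -> D t -> (forall s, 0 <= E s) ->
  (forall s, D s -> is_derive s 1 E (c * E s)) ->
  0 <= c * (t - x) -> E x <= E t.
Proof.
move=> iD Dx Dt E0 dE.
have mvt (a b : R) : D a -> D b -> a <= b -> exists s, E b - E a = c * E s * (b - a).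
  move=> Da Db ab.
  have Dab s : s \in `[a, b]%R -> D s.
    by rewrite in_itv /= => sab; exact: (iD a b).
  have [s||s _ ->] := @MVT_segment R E (fun s => c * E s) a b ab; last by exists s.
  - by move=> /subset_itv_oo_cc /Dab; exact: dE.
  - apply: derivable_within_continuous => s /Dab Ds.
    by have [] := dE s Ds.
have [xt|tx] := leP x t => ct; rewrite -subr_ge0.
  by have [s ->] := mvt x t Dx Dt xt; rewrite mulrAC mulr_ge0.
have [s e] := mvt t x Dt Dx (ltW tx).
by rewrite -opprB e -mulrN opprB mulrAC mulr_ge0.
Qed.

(* The squared modulus satisfies E' = 2 (Re rho) E, hence is monotone towards F. *)
Lemma exponential_eq0 F D y rho (x : R) : ProperFilter F ->
  is_interval D -> (forall s, D s -> is_scderive s y (rho * y s)) ->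
  sccvg y F 0 ->
  D x -> (\forall t \near F, D t /\ 0 <= complex.Re rho * (t - x)) -> y x = 0.
Proof.
move=> FF iD dy [y1 y2] Dx nF.
pose E := (@complex.Re R \o y) ^+ 2 + (@complex.Im R \o y) ^+ 2.
have E0 s : 0 <= E s by rewrite addr_ge0 // sqr_ge0.
have dE s : D s -> is_derive s 1 E (2 * complex.Re rho * E s).
  move=> /dy [d1 d2].
  apply: (is_derive_eq (is_deriveD (is_deriveX 2 d1) (is_deriveX 2 d2))).
  (* The terms in Im rho cancel; adding 0 gives the product the shape [c * a + b]. *)
  rewrite -[rho * y s]addr0 (ReD_mul rho) (ImD_mul rho) /= !addr0 /GRing.scale /= /E !fctE /=.
  ring.
have EF : E t @[t --> F] --> (0 : R).
  by have := cvgD (cvgM y1 y1) (cvgM y2 y2); rewrite /= !mulr0 addr0; exact.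
have : E x <= 0.
  apply: (cvgr_to_ge EF); apply: filterS nF => t [Dt ct].
  by apply: (@growth_le E (2 * complex.Re rho) D) => //; rewrite -mulrA mulr_ge0.
rewrite /E !fctE /= => Ex; apply/eqP; rewrite eq_complex /=.
by apply/andP; split; apply/eqP; nra.
Qed.

(** A real sum makes the imaginary parts b and -b, so Re mu Re rho = - Re lam - b^2 <= 0. Equality
    would force b = 0 and Re lam = 0, then Im lam = 0. *)
Lemma char_roots_split (h : R) lam mu rho :
  0 <= complex.Re lam -> lam != 0 -> mu + rho = h%:C%C -> mu * rho = - lam ->
  complex.Re mu * complex.Re rho < 0.
Proof.
case: lam mu rho => [p q] [a b] [c d] /= p0 pq0 [_ bd] [pE qE].
have dE : d = - b by lra.
rewrite {}dE in pE qE.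
have : a * c <= 0 by nra.
rewrite le_eqVlt => /predU1P[ac0|//].
have b0 : b = 0 by nra.
by move: pq0; rewrite eq_complex /= => /negP[]; apply/andP; split; apply/eqP; nra.
Qed.

(* mu and rho are the roots of X^2 - h X - lam. *)
Lemma char_roots (h : R) lam :
  0 <= complex.Re lam -> lam != 0 ->
  exists mu rho, [/\ mu + rho = h%:C%C, mu * rho = - lam,
    0 < complex.Re mu & complex.Re rho < 0].
Proof.
move=> lam_ge0 lam0.
pose s := sqrtc (h%:C%C ^+ 2 + 4 * lam).
have s2 : s ^+ 2 = h%:C%C ^+ 2 + 4 * lam by exact: sqr_sqrtc.
pose mu := (h%:C%C + s) / 2; pose rho := (h%:C%C - s) / 2.
have sE : mu + rho = h%:C%C by rewrite /mu /rho; field.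
have pE : mu * rho = - lam.
  have -> : mu * rho = (h%:C%C ^+ 2 - s ^+ 2) / 4 by rewrite /mu /rho; field.
  by rewrite s2; field.
have Hlt := char_roots_split lam_ge0 lam0 sE pE.
have [m0|m0] := ltP 0 (complex.Re mu).
  by exists mu, rho; split => //; nra.
have mu_lt0 : complex.Re mu < 0.
  by rewrite lt_neqAle m0 andbT; apply: contraTneq Hlt => ->; rewrite mul0r ltxx.
by exists rho, mu; split; rewrite 1?[rho + _]addrC 1?[rho * _]mulrC //; nra.
Qed.

Definition linear_eq (h : R) lam v z D : Prop :=
  forall x, D x -> is_scderive x v (h%:C%C * v x + z x) /\ is_scderive x z (lam * v x).

Section HalfLine.
Variables (h : R) (lam : R[i]) (v z : R -> R[i]) (D : set R).
Hypotheses (iD : is_interval D) (vz : linear_eq h lam v z D).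
Variables (mu rho : R[i]).
Hypotheses (sum_roots : mu + rho = h%:C%C) (prod_roots : mu * rho = - lam).

(** Since rho^2 = h rho + lam, the function y = rho v + z satisfies y' = rho y, and it tends to 0
    along [F], which will be an infinite end. *)
Lemma decaying_combination F (x : R) : ProperFilter F ->
  sccvg v F 0 -> sccvg z F 0 ->
  D x -> (\forall t \near F, D t /\ 0 <= complex.Re rho * (t - x)) ->
  rho * v x + z x = 0.
Proof.
move=> FF vF zF Dx nF.
apply: (@exponential_eq0 F D (fun t => rho * v t + z t) rho x) => //.
- move=> s /vz [dv dz].
  have -> : rho * (rho * v s + z s) = rho * (h%:C%C * v s + z s) + lam * v s.
    by rewrite -sum_roots -[lam]opprK -prod_roots; ring.
  exact: is_scderive_lin.
- by have := sccvg_lin rho FF vF zF; rewrite mulr0 addr0.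
Qed.

(** Substituting z = - rho v gives v' = (h - rho) v = mu v. Here [F] will be a one-sided
    neighbourhood of 0, where v tends to 0. *)
Lemma combination_eq0 F (x : R) : ProperFilter F ->
  (forall s, D s -> rho * v s + z s = 0) -> sccvg v F 0 ->
  D x -> (\forall t \near F, D t /\ 0 <= complex.Re mu * (t - x)) ->
  v x = 0 /\ z x = 0.
Proof.
move=> FF vz0 vF Dx nF.
have vx : v x = 0.
  apply: (@exponential_eq0 F D v mu x) => // s Ds.
  have [dv _] := vz Ds.
  suff -> : mu * v s = h%:C%C * v s + z s by [].
  by rewrite -[mu](addrK rho) sum_roots -[z s](addKr (rho * v s)) vz0 //; ring.
by split => //; have := vz0 _ Dx; rewrite vx mulr0 add0r.
Qed.

End HalfLine.

(* The decaying solutions on the two half lines satisfy z = - rho v with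
   Re rho < 0 on the left and Re rho > 0 on the right, so that no positive
   jump factor k can match them. *)
Lemma jump_problem_eq0 (hl hr k : R) lam (v z : R -> R[i]) (vm z0 : R[i]) :
  0 <= complex.Re lam -> lam != 0 -> 0 < k ->
  linear_eq hl lam v z [set x | x < 0] ->
  linear_eq hr lam v z [set x | 0 < x] ->
  sccvg v 0^'- vm -> sccvg v 0^'+ (k%:C%C * vm) ->
  sccvg z 0^'- z0 -> sccvg z 0^'+ z0 ->
  sccvg v -oo 0 -> sccvg v +oo 0 -> sccvg z -oo 0 -> sccvg z +oo 0 ->
  vm = 0 /\ forall x, x != 0 -> v x = 0 /\ z x = 0.
Proof.
move=> lam_ge0 lam0 k0 eql eqr vl vr zl zr vNy vy zNy zy.
have [mul [rhol [sl pl mul0 rhol0]]] := char_roots hl lam_ge0 lam0.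
have [rhor [mur [sr pr rhor0 mur0]]] := char_roots hr lam_ge0 lam0.
(* On the right half line the two roots exchange roles: the vanishing combination uses the root with
   positive real part. *)
rewrite addrC in sr; rewrite mulrC in pr.
have il : is_interval [set x : R | x < 0].
  by move=> ? b /= _ b0 c /andP[_ cb]; exact: le_lt_trans cb b0.
have ir : is_interval [set x : R | 0 < x].
  by move=> a ? /= a0 _ c /andP[ac _]; exact: lt_le_trans a0 ac.
have cl x : x < 0 -> rhol * v x + z x = 0.
  move=> x0; apply: (decaying_combination il eql sl pl _ vNy zNy) => //.
  near=> t; split => /=; first by near: t; exact: nbhs_ninfty_lt.
  have tx : t <= x by near: t; apply: nbhs_ninfty_le; exact: num_real.
  by nra.
have cr x : 0 < x -> rhor * v x + z x = 0.
  move=> x0; apply: (decaying_combination ir eqr sr pr _ vy zy) => //.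
  near=> t; split => /=; first by near: t; exact: nbhs_pinfty_gt.
  have tx : x <= t by near: t; apply: nbhs_pinfty_ge; exact: num_real.
  by nra.
(* The relations on the half lines pass to the one-sided limits at 0. *)
have bl : rhol * vm + z0 = 0.
  apply: (sccvg_unique _ (sccvg_lin rhol _ vl zl)); 
  apply: (@eq_sccvg _ (fun=> 0)); last exact: sccvg_cst.
  by near=> t; rewrite cl //; near: t; exact: nbhs_left_lt.
have br : rhor * (k%:C%C * vm) + z0 = 0.
  apply: (sccvg_unique _ (sccvg_lin rhor _ vr zr)); 
  apply: (@eq_sccvg _ (fun=> 0)); last exact: sccvg_cst.
  by near=> t; rewrite cr //; near: t; exact: nbhs_right_gt.
(* Eliminating z0 leaves the factor k rhor - rhol, whose real part is positive. *)
have vm0 : vm = 0.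
  have /eqP : (rhor * k%:C%C - rhol) * vm = 0.
    by rewrite -[RHS](subrr 0) -{1}br -bl; ring.
  rewrite mulf_eq0 => /orP[/eqP /(congr1 (@complex.Re R)) e|/eqP//].
  by exfalso; move: e; rewrite ReD_mul raddfN /= mulr0; nra.
rewrite vm0 mulr0 in vl vr *; split => // x.
rewrite neq_lt => /orP[x0|x0].
- apply: (combination_eq0 il eql sl _ cl vl) => //.
  near=> t; split => /=; first by near: t; exact: nbhs_left_lt.
  have tx : x < t by near: t; exact: nbhs_left_gt.
  by nra.
- apply: (combination_eq0 ir eqr sr _ cr vr) => //.
  near=> t; split => /=; first by near: t; exact: nbhs_right_gt.
  have tx : t < x by near: t; exact: nbhs_right_lt.
  by nra.
Unshelve. all: by end_near. Qed.

End ScalarEquations.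

(** * Reduction of the planar problem to its coordinates *)

Section Coordinates.
Local Open Scope classical_set_scope.
Variable R : realType.

Lemma is_derive_coord m n (M : R -> 'M[R]_(m.+1, n.+1)) (x : R) dM i j :
  is_derive x 1 M dM -> is_derive x 1 (fun t => M t i j) (dM i j).
Proof.
move=> [dx <-]; split; first exact: (derivable_mxP M x 1).1.
by rewrite derive_mx // mxE.
Qed.

Lemma is_cderive_coord (g : R -> 'cV[R[i]]_2) (x : R) d j :
  is_cderive x g d -> is_scderive x (fun t => g t j 0) (d j 0).
Proof.
move=> [/(@is_derive_coord _ _ _ _ _ j 0) d1 /(@is_derive_coord _ _ _ _ _ j 0) d2].
split; [move: d1 | move: d2]; rewrite mxE;
  by under [X in is_derive _ _ X _ -> _]eq_fun do rewrite mxE.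
Qed.

Lemma ccvg_coord (g : R -> 'cV[R[i]]_2) (F : set_system R) l j : Filter F ->
  ccvg g F l -> sccvg (fun t => g t j 0) F (l j 0).
Proof.
move=> FF [l1 l2]; split.
- have := cvg_comp _ _ l1 (@coord_continuous R 2 1 j 0 (cRe l)).
  by rewrite /comp mxE; under eq_fun do rewrite mxE.
- have := cvg_comp _ _ l2 (@coord_continuous R 2 1 j 0 (cIm l)).
  by rewrite /comp mxE; under eq_fun do rewrite mxE.
Qed.

Lemma dot_normal (K : pzRingType) (a : 'cV[K]_2) : dot a (delta_mx 1 0) = a 1 0.
Proof.
by rewrite /dot big_ord_recl big_ord1 !mxE /= mulr0 mulr1 add0r; congr (a _ _); apply/val_inj.
Qed.

Lemma jumpE (Qm Qp : 'M[R]_2) um up w (a : 'cV[R[i]]_2) i :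
  let fm := fhat_m Qm um w in let fp := fhat_p Qp up w in
  jump Qm Qp um up w a i 0 =
  a i 0 + a 1 0 / (fm 1 0)%:C%C * (fp i 0 - fm i 0)%:C%C.
Proof. by rewrite /= /jump /toC /normal map_delta_mx !dot_normal !mxE. Qed.

Lemma linear_eq_coord (h : 'rV[R]_2) lam (v z : R -> 'cV[R[i]]_2) (D : set R) j :
  (forall x, D x -> is_cderive x v (toC (diag_mx h) *m v x + z x) /\
    is_cderive x z (lam *: v x)) ->
  linear_eq (h 0 j) lam (fun x => v x j 0) (fun x => z x j 0) D.
Proof.
move=> vz x /vz [/(is_cderive_coord j) + /(is_cderive_coord j)].
by rewrite /toC map_diag_mx mul_diag_mx !mxE.
Qed.

End Coordinates.

(** * Signs of the second diagonal entries forced by the heteroclinic *)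

Section Transversality.
Local Open Scope classical_set_scope.
Variables (R : realType) (um up w : 'cV[R]_2) (hm hp : 'rV[R]_2).
Variables (f : 'cV[R]_2 -> 'cV[R]_2) (gamma : R -> 'cV[R]_2).
Hypothesis gamma_het : heteroclinic (diag_mx hm) (diag_mx hp) um up w f gamma.

Lemma expmx_diag_coord (h : 'rV[R]_2) (x : R) (a : 'cV[R]_2) j :
  (expmx (x *: diag_mx h) *m a) j 0 = expR (x * h 0 j) * a j 0.
Proof.
rewrite (_ : x *: diag_mx h = diag_mx (x *: h)) ?expmx_diag ?mul_diag_mx ?mxE //.
by rewrite linearZ.
Qed.

Lemma heteroclinic_left_exp x : x <= 0 ->
  gamma x 1 0 = um 1 0 - expR (x * hm 0 1) * um 1 0.
Proof.
move=> /(het_left gamma_het) ->; rewrite mxE expmx_diag_coord !mxE.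
by rewrite (het_cross gamma_het) sub0r mulrN.
Qed.

Lemma heteroclinic_right_exp x : 0 <= x ->
  gamma x 1 0 = up 1 0 - expR (x * hp 0 1) * up 1 0.
Proof.
move=> /(het_right gamma_het) ->; rewrite mxE expmx_diag_coord !mxE.
by rewrite (het_cross gamma_het) sub0r mulrN.
Qed.

(* Otherwise the exponential is at least 1 and gamma never enters the side of Sigma containing um. *)
Lemma heteroclinic_unstable : um 1 0 < 0 -> 0 < hm 0 1.
Proof.
move=> um_lt0; rewrite ltNge; apply/negP => h_le0.
have lim_um := cvg_comp _ _ (het_ninfty gamma_het) (@coord_continuous R 2 1 1 0 um).
suff : 0 <= um 1 0 by rewrite leNgt um_lt0.
apply: (cvgr_to_ge lim_um); near=> x.
have x_le0 : x <= 0 by near: x; apply: nbhs_ninfty_le; exact: num_real.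
rewrite /= heteroclinic_left_exp //.
have : 1 <= expR (x * hm 0 1) by rewrite -expR0 ler_expR mulr_le0.
by nra.
Unshelve. all: by end_near. Qed.

(** Mirror image at +oo: otherwise the second coordinate of gamma stays nonpositive for x >= 0 and
    cannot tend to a positive limit. *)
Lemma heteroclinic_stable : 0 < up 1 0 -> hp 0 1 < 0.
Proof.
move=> up_gt0; rewrite ltNge; apply/negP => h_ge0.
have lim_up := cvg_comp _ _ (het_pinfty gamma_het) (@coord_continuous R 2 1 1 0 up).
suff : up 1 0 <= 0 by rewrite leNgt up_gt0.
apply: (cvgr_to_le lim_up); near=> x.
have x_ge0 : 0 <= x by near: x; apply: nbhs_pinfty_ge; exact: num_real.
rewrite /= heteroclinic_right_exp //.
have : 1 <= expR (x * hp 0 1) by rewrite -expR0 ler_expR mulr_ge0.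
by nra.
Unshelve. all: by end_near. Qed.

End Transversality.

Unset Implicit Arguments.

Theorem theorem1 (R : realType) (um up w : 'cV[R]_2) (hm hp : 'rV[R]_2)
    (f : 'cV[R]_2 -> 'cV[R]_2) (gamma : R -> 'cV[R]_2)
    (um2_lt0 : um 1 0 < 0) (up2_gt0 : 0 < up 1 0)
    (hm_pos : 0 < hm 0 0 \/ 0 < hm 0 1)
    (hp_neg : hp 0 0 < 0 \/ hp 0 1 < 0)
    (f_def : piecewise_affine (diag_mx hm) (diag_mx hp) um up f)
    (gamma_het : heteroclinic (diag_mx hm) (diag_mx hp) um up w f gamma) :
  forall lambda : R[i],
    is_eigenvalue (diag_mx hm) (diag_mx hp) um up w lambda ->
    complex.Re lambda < 0 \/ lambda = 0.
Proof.
move=> lam [v [z vz]].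
have [|lam_ge0] := ltP (complex.Re lam) 0; first by left.
have [|lam0] := eqVneq lam 0; [by right | exfalso].
have [vm [vp [vml vpr vpE]]] := eig_v_jump vz.
have [z0 [z0l z0r]] := eig_z_cont vz.
have w0 : w 1 0 = 0 := het_cross gamma_het.
(* Transversality: this is h_2^- (0 - u_2^-), with both factors positive; on the plus side both
   factors are negative. *)
have fm_gt0 : 0 < fhat_m (diag_mx hm) um w 1 0.
  rewrite /fhat_m mul_diag_mx !mxE w0.
  by have := heteroclinic_unstable gamma_het um2_lt0; nra.
have fp_gt0 : 0 < fhat_p (diag_mx hp) up w 1 0.
  rewrite /fhat_p mul_diag_mx !mxE w0.
  by have := heteroclinic_stable gamma_het up2_gt0; nra.
have coord_eq0 (j : 'I_2) (k : R) : 0 < k -> vp j 0 = k%:C%C * vm j 0 ->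
    vm j 0 = 0 /\ forall x, x != 0 -> v x j 0 = 0 /\ z x j 0 = 0.
  move=> k0 vpk.
  apply: (@jump_problem_eq0 R (hm 0 j) (hp 0 j) k lam _ _ (vm j 0) (z0 j 0)) => //;
    try (apply: linear_eq_coord; by [exact: (eig_left vz)|exact: (eig_right vz)]);
    rewrite -?vpk; try exact: ccvg_coord.
  - have := ccvg_coord j _ (eig_v_ninfty vz); rewrite mxE; exact.
  - have := ccvg_coord j _ (eig_v_pinfty vz); rewrite mxE; exact.
  - have := ccvg_coord j _ (eig_z_ninfty vz); rewrite mxE; exact.
  - have := ccvg_coord j _ (eig_z_pinfty vz); rewrite mxE; exact.
(* In this coordinate the jump v + (fp - fm) v / fm is multiplication by k = fp / fm > 0. *)
have [vm1 vz1] : vm 1 0 = 0 /\ forall x, x != 0 -> v x 1 0 = 0 /\ z x 1 0 = 0.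
  apply: (coord_eq0 1 (fhat_p (diag_mx hp) up w 1 0 / fhat_m (diag_mx hm) um w 1 0)).
    exact: divr_gt0.
  rewrite vpE jumpE rmorphM fmorphV rmorphB /=; field.
  by rewrite fmorph_eq0 gt_eqF.
(* The jump of the first coordinate is proportional to [vm 1 0], now known to vanish, so k = 1. *)
have [_ vz0] : vm 0 0 = 0 /\ forall x, x != 0 -> v x 0 0 = 0 /\ z x 0 0 = 0.
  by apply: (coord_eq0 0 1) => //; rewrite vpE jumpE vm1 !mul0r addr0 mul1r.
have [x [x0 vzx]] := eig_nontrivial vz.
have [v0x z0x] := vz0 x x0; have [v1x z1x] := vz1 x x0.
have col0 (a : 'cV[R[i]]_2) : a 0 0 = 0 -> a 1 0 = 0 -> a = 0.
  move=> a0 a1; apply/colP => i; rewrite mxE.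
  by case: i => [[|[|//]] ilt]; [rewrite -a0 | rewrite -a1]; congr (a _ _); apply/val_inj.
by case: vzx => /eqP; apply; exact: col0.
Qed.
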